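(* Over a field of characteristic different from $2$, the codimensions of the variety $\mathfrak B_{\rm sup}$ of bicommutative superalgebras are $$c_{p,q}(\mathfrak B_{\rm sup})=\begin{cases}2^{p+q}-2,&\text{if }p+q>1;\\1,&\text{if }p+q=1,\end{cases}\qquad c_n(\mathfrak B_{\rm sup})=\begin{cases}2^{2n}-2^{n+1},&\text{if }n>1;\\2,&\text{if }n=1.\end{cases}$$
   Context: Algebras are not assumed associative or unital. A superalgebra is an algebra $A=A_0\oplus A_1$ with $A_iA_j\subseteq A_{i+j\,(\mathrm{mod}\,2)}$; for $a\in A_i$ write $\overline a=i$. A superalgebra is bicommutative if for all homogeneous elements $x_1(x_2x_3)=(-1)^{\overline{x_1}\,\overline{x_2}}x_2(x_1x_3)$ and $(x_1x_2)x_3=(-1)^{\overline{x_2}\,\overline{x_3}}(x_1x_3)x_2$. $F(\mathfrak B_{\rm sup})$ is the free bicommutative superalgebra on even generators $y_1,y_2,\dots$ and odd generators $z_1,z_2,\dots$ (universal property with respect to parity-preserving maps). For $p,q\ge0$, $p+q>0$, $c_{p,q}(\mathfrak B_{\rm sup})=\dim P_{p,q}(\mathfrak B_{\rm sup})$, where $P_{p,q}(\mathfrak B_{\rm sup})$ is the multilinear component of $F(\mathfrak B_{\rm sup})$ in the variables $y_1,\dots,y_p,z_1,\dots,z_q$ (elements of degree exactly $1$ in each of these variables and $0$ in all others). For $n\ge1$, $c_n(\mathfrak B_{\rm sup})=\dim P_n(\mathfrak B_{\rm sup})$, where $P_n(\mathfrak B_{\rm sup})$ is the multilinear component in $x_1,\dots,x_n$,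 each $x_i$ being equal either to $y_i$ or to $z_i$ (the direct sum over all $2^n$ such choices); thus $c_n(\mathfrak B_{\rm sup})=\sum_{p=0}^n\binom npc_{p,n-p}(\mathfrak B_{\rm sup})$. *)

(* Defs.v *)
From HB Require Import structures.
From mathcomp Require Import all_boot all_order all_algebra.
Set Implicit Arguments.
Unset Strict Implicit.
Unset Printing Implicit Defensive.
Import GRing.Theory.
Local Open Scope ring_scope.

(* Parities are booleans: [false] is even, [true] is odd, [(+)] is addition
   modulo 2.  The product is neither associative nor unital in general. *)
Record superalgebra (K : fieldType) := Superalgebra {
  carrier :> lmodType K;
  smul : {bilinear carrier -> carrier -> carrier};
  part : bool -> submodClosed carrier;
  part_smul : forall i j a b,
    a \in part i -> b \in part j -> smul a b \in part (i (+) j);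
  part_span : forall a, exists a0 a1,
    [/\ a0 \in part false, a1 \in part true & a = a0 + a1];
  part_direct : forall a, a \in part false -> a \in part true -> a = 0
}.

Declare Scope superalgebra_scope.
Notation "a ** b" := (smul _ a b)
  (at level 40, left associativity) : superalgebra_scope.
Local Open Scope superalgebra_scope.

Definition bicommutative (K : fieldType) (A : superalgebra K) : Prop :=
  forall (i j k : bool) (a b c : A),
    a \in part A i -> b \in part A j -> c \in part A k ->
    a ** (b ** c) = (-1) ^+ (i && j) *: (b ** (a ** c)) /\
    (a ** b) ** c = (-1) ^+ (j && k) *: ((a ** c) ** b).

Definition superalgebra_hom (K : fieldType) (A B : superalgebra K)
    (f : {linear A -> B}) : Prop :=
  (forall a b : A, f (a ** b) = f a ** f b) /\
  (forall (i : bool) (a : A), a \in part A i -> f a \in part B i).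

(* [(false, i)] stands for the even generator y_{i+1} and [(true, i)] for the
   odd generator z_{i+1}. *)
Definition generator : Type := (bool * nat)%type.

Definition parity_preserving (K : fieldType) (A : superalgebra K)
    (g : generator -> A) : Prop :=
  forall x : generator, g x \in part A x.1.

Definition free_bicommutative (K : fieldType) (F : superalgebra K)
    (g : generator -> F) : Prop :=
  [/\ bicommutative F, parity_preserving g &
      forall (B : superalgebra K) (h : generator -> B),
        bicommutative B -> parity_preserving h ->
        exists f : {linear F -> B},
          [/\ superalgebra_hom f, (forall x, f (g x) = h x) &
              forall f' : {linear F -> B}, superalgebra_hom f' ->
                (forall x, f' (g x) = h x) -> f' =1 f]].

Inductive monomial : Type :=
  | Var of generator
  | Prod of monomial & monomial.

Fixpoint degree_in (x : generator) (m : monomial) : nat :=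
  match m with
  | Var y => (y == x)%N
  | Prod m1 m2 => degree_in x m1 + degree_in x m2
  end.

Fixpoint eval (K : fieldType) (A : superalgebra K) (g : generator -> A)
    (m : monomial) : A :=
  match m with
  | Var x => g x
  | Prod m1 m2 => eval g m1 ** eval g m2
  end.

(* Linear span of the monomials of degree 1 in each generator of [V] and of
   degree 0 in all the others. *)
Definition multilinear (K : fieldType) (F : superalgebra K)
    (g : generator -> F) (V : pred generator) (v : F) : Prop :=
  exists (n : nat) (c : 'I_n -> K) (m : 'I_n -> monomial),
    (forall i x, degree_in x (m i) = V x) /\
    v = \sum_(i < n) c i *: eval g (m i).

Definition P_pq (K : fieldType) (F : superalgebra K) (g : generator -> F)
    (p q : nat) : F -> Prop :=
  multilinear g (fun x => if x.1 then (x.2 < q)%N else (x.2 < p)%N).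

(* The variables x_1, ..., x_n, where x_i is z_i if [e] holds at i and y_i
   otherwise. *)
Definition chosen (n : nat) (e : {ffun 'I_n -> bool}) : pred generator :=
  fun x => [exists i : 'I_n, x == (e i, val i)].

Definition P_n (K : fieldType) (F : superalgebra K) (g : generator -> F)
    (n : nat) (v : F) : Prop :=
  exists w : {ffun 'I_n -> bool} -> F,
    (forall e, multilinear g (chosen e) (w e)) /\ v = \sum_e w e.

(* The subspace [S] has a basis with [d] elements. *)
Definition has_dim (K : fieldType) (V : lmodType K) (S : V -> Prop)
    (d : nat) : Prop :=
  exists b : 'I_d -> V,
    [/\ forall i, S (b i),
        forall c : 'I_d -> K, \sum_i c i *: b i = 0 -> forall i, c i = 0 &
        forall v, S v -> exists c : 'I_d -> K, v = \sum_i c i *: b i].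

(* Main.v *)
Require Import Defs.
From HB Require Import structures.
From mathcomp Require Import all_boot all_order all_algebra ring.
(** Up to sign, a nonassociative monomial of degree at least 2 in a bicommutative
superalgebra depends only on which letters act from the left and which act from
the right.  Left multiplications commute up to sign, so do right
multiplications, and on products the two kinds commute with each other as well
([sign_eq_leftright]).  Hence every product of letters is, up to sign,
[((x1 (x2 (... (xk y0)))) y1) ... yl] with [k >= 1], and the order of the [x]'s
and the order of the [y]'s are immaterial ([normal_form],
[perm_normal_monomial]).  For [n >= 2] distinct generators, the multilinear
component is therefore spanned by one monomial for each splitting of the
generators into a nonempty left part and a nonempty right part; there are
[2 ^ n - 2] of them.

These monomials are linearly independent because a concrete bicommutative
superalgebra separates them.  Take the supercommutative associative algebra
[C] spanned by the square-free words in two copies [u_x], [v_x] of the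
letters, where every letter squares to 0, and put on [span(x) + C] the product
[a b = lambda(a) rho(b)], where [lambda] and [rho] are the identity on [C] and
send [x] to [u_x] and [v_x].  Both bicommutative identities reduce to
supercommutativity and associativity of [C] ([model_bicommutative]).  A
normal monomial with left part [I] and right part [J] is sent to plus or minus
the product of the [u_x], [x] in [I], and of the [v_y], [y] in [J], and these
products are distinct basis vectors ([monomials_free]).

All these components are handled together, as sums of the components
of a finite family of distinct sets of [n] generators ([has_dim_family]): one
set for [c_{p,q}], all [2 ^ n] choices of parities for [c_n].  Since the model
contains the letters of all the sets of the family at once, it also shows that
the sum is direct. *)

Set Implicit Arguments.
Unset Strict Implicit.
Unset Printing Implicit Defensive.
Import GRing.Theory.
Local Open Scope ring_scope.
Local Open Scope superalgebra_scope.

(** * Checking the bicommutative identities on a homogeneous basis *)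

Section Smul.
Variables (K : fieldType) (A : superalgebra K).
Implicit Types a b c : A.

Lemma smulZl k a b : (k *: a) ** b = k *: (a ** b).
Proof. exact: linearZl_LR. Qed.

Lemma smulZr k a b : a ** (k *: b) = k *: (a ** b).
Proof. exact: linearZr_LR. Qed.

Lemma smul_suml I (r : seq I) (P : pred I) (F : I -> A) b :
  (\sum_(i <- r | P i) F i) ** b = \sum_(i <- r | P i) F i ** b.
Proof. exact: linear_sumlz. Qed.

Lemma smul_sumr I (r : seq I) (P : pred I) (F : I -> A) a :
  a ** (\sum_(i <- r | P i) F i) = \sum_(i <- r | P i) a ** F i.
Proof. exact: linear_sumr. Qed.

(** The signs depend on parities only, so both identities, being trilinear, can
be tested on a basis adapted to the grading. *)
Lemma bicommutative_basis (I : finType) (e : I -> A) (d : I -> bool) :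
  (forall p a, a \in part A p ->
     exists c : I -> K, a = \sum_(i | d i == p) c i *: e i) ->
  (forall i j k,
     e i ** (e j ** e k) = (-1) ^+ (d i && d j) *: (e j ** (e i ** e k))) ->
  (forall i j k,
     (e i ** e j) ** e k = (-1) ^+ (d j && d k) *: ((e i ** e k) ** e j)) ->
  bicommutative A.
Proof.
move=> span lid rid p q r _ _ _ /span[a ->] /span[b ->] /span[c ->]; split.
  rewrite !smul_suml scaler_sumr.
  under eq_bigr do rewrite smul_sumr.
  under [RHS]eq_bigr do rewrite smul_sumr scaler_sumr.
  rewrite [RHS]exchange_big /=; apply: eq_bigr => i /eqP pi.
  apply: eq_bigr => j /eqP pj; rewrite !smul_sumr scaler_sumr.
  apply: eq_bigr => k _; rewrite !(smulZl, smulZr) lid pi pj !scalerA.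
  by congr (_ *: _); ring.
rewrite !smul_suml scaler_sumr; apply: eq_bigr => i _.
rewrite !smul_sumr scaler_sumr.
under eq_bigr do rewrite smul_suml.
under [RHS]eq_bigr do rewrite smul_suml scaler_sumr.
rewrite [RHS]exchange_big /=; apply: eq_bigr => k /eqP pk.
apply: eq_bigr => j /eqP pj; rewrite !(smulZl, smulZr) rid pj pk !scalerA.
by congr (_ *: _); ring.
Qed.

End Smul.

(** * A bicommutative superalgebra separating multilinear monomials *)

Section Model.
Variables (K : fieldType) (G : finType) (parity : G -> bool).

(** [(false, x)] is the letter [u_x], [(true, x)] the letter [v_x]. *)
Definition letter : Type := (bool * G)%type.
(** Basis of the model: the generators, and the square-free words in the letters,
encoded as sets.  Repeated letters are killed, which multilinear monomials do not
see and which keeps the model finite-dimensional. *)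
Definition model_index : Type := (G + {set letter})%type.
Local Notation model_space := {ffun model_index -> K^o}.

Definition word_parity (S : {set letter}) : bool :=
  odd (\sum_(s in S) parity s.2).
Definition index_parity (i : model_index) : bool :=
  match i with inl x => parity x | inr A => word_parity A end.
(** The maps [lambda] and [rho] on basis vectors. *)
Definition lword (i : model_index) : {set letter} :=
  match i with inl x => [set (false, x)] | inr A => A end.
Definition rword (i : model_index) : {set letter} :=
  match i with inl x => [set (true, x)] | inr A => A end.

(** The sign of the transposition that puts [s] and [t] in increasing order.  The
value 0 at [s = t] makes the product of two words vanish as soon as they share a
letter, so that no disjointness condition is needed in the product. *)
Definition letter_sgn (s t : letter) : K :=
  if s == t then 0
  else if (enum_rank t < enum_rank s)%N then (-1) ^+ (parity s.2 * parity t.2)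
  else 1.
Definition word_sgn (S T : {set letter}) : K :=
  \prod_(s in S) \prod_(t in T) letter_sgn s t.

Implicit Types S T U : {set letter}.

Lemma letter_sgnC s t :
  letter_sgn s t = (-1) ^+ (parity s.2 * parity t.2) * letter_sgn t s.
Proof.
rewrite /letter_sgn eq_sym; case: eqVneq => [_|ne]; first by rewrite mulr0.
rewrite mulnC; case: ltngtP => [||/ord_inj/enum_rank_inj e]; last 1 first.
- by rewrite e eqxx in ne.
- by rewrite mulr1.
- by rewrite -expr2 sqrr_sign.
Qed.

(** Supercommutativity of the word algebra: the sign is bimultiplicative, so the
identity follows from the case of two letters. *)
Lemma word_sgnC S T :
  word_sgn S T = (-1) ^+ (word_parity S && word_parity T) * word_sgn T S.
Proof.
rewrite /word_sgn [X in _ = _ * X]exchange_big /= /word_parity -oddM signr_odd.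
rewrite big_distrl expr_sum -big_split /=; apply: eq_bigr => s _.
rewrite big_distrr expr_sum -big_split /=; apply: eq_bigr => t _.
exact: letter_sgnC.
Qed.

Lemma word_sgn_neq0 S T : (word_sgn S T != 0) = [disjoint S & T].
Proof.
apply/idP/idP => [/prodf_neq0 nz|dST].
  apply/pred0P => s; apply/negP => /andP [/= Ss Ts].
  by have /prodf_neq0/(_ s Ts) := nz s Ss; rewrite /letter_sgn !eqxx.
apply/prodf_neq0 => s Ss; apply/prodf_neq0 => t Tt; rewrite /letter_sgn.
case: ifPn => [/eqP est|_]; last first.
  by case: ifP => _; rewrite ?signr_eq0 ?oner_eq0.
by rewrite -est (disjointFr dST Ss) in Tt.
Qed.

Lemma word_sgnUl S T U : [disjoint S & T] ->
  word_sgn (S :|: T) U = word_sgn S U * word_sgn T U.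
Proof.
by move=> dST; rewrite /word_sgn -bigU //; apply: eq_bigl => s; rewrite !inE.
Qed.

Lemma word_sgnUr S T U : [disjoint T & U] ->
  word_sgn S (T :|: U) = word_sgn S T * word_sgn S U.
Proof.
move=> dTU; rewrite /word_sgn -big_split; apply: eq_bigr => s _ /=.
by rewrite -bigU //; apply: eq_bigl => t; rewrite !inE.
Qed.

(** Associativity of the word algebra.  For disjoint words both sides are the
product of the three mutual signs, and any overlap makes both sides vanish. *)
Lemma word_sgn_cocycle S T U :
  word_sgn S T * word_sgn (S :|: T) U = word_sgn S (T :|: U) * word_sgn T U.
Proof.
have [dST|] := boolP [disjoint S & T]; last first.
  move=> nST; move: (nST); rewrite -word_sgn_neq0 negbK => /eqP ->.
  have: ~~ [disjoint S & T :|: U].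
    by apply: contraNN nST => /disjointWr; apply; apply: subsetUl.
  by rewrite -word_sgn_neq0 negbK => /eqP ->; rewrite !mul0r.
have [dTU|] := boolP [disjoint T & U]; last first.
  move=> nTU; move: (nTU); rewrite -word_sgn_neq0 negbK => /eqP ->.
  have: ~~ [disjoint S :|: T & U].
    by apply: contraNN nTU => /disjointWl; apply; apply: subsetUr.
  by rewrite -word_sgn_neq0 negbK => /eqP ->; rewrite !mulr0.
by rewrite word_sgnUl // word_sgnUr // mulrA.
Qed.

Definition bvec (i : model_index) : model_space := [ffun j => (j == i)%:R].

Definition model_mul (a b : model_space) : model_space :=
  \sum_i \sum_j (a i * b j * word_sgn (lword i) (rword j)) *:
    bvec (inr (lword i :|: rword j)).

Lemma model_mul_bilinear : bilinear_for *:%R *:%R model_mul.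
Proof.
split=> [c|c] k a b; rewrite /= /model_mul scaler_sumr -big_split /=;
  apply: eq_bigr => i _; rewrite scaler_sumr -big_split /=;
  apply: eq_bigr => j _; rewrite scalerA -scalerDl !ffunE;
  congr (_ *: _).
by rewrite !mulrDl !mulrA.
by rewrite mulrDr mulrDl !mulrA (mulrC _ k).
Qed.

HB.instance Definition _ :=
  bilinear_isBilinear.Build K _ _ _ _ _ model_mul model_mul_bilinear.

Definition homog (p : bool) : pred model_space :=
  fun a => [forall i, (a i != 0) ==> (index_parity i == p)].

Lemma homog_submod p : subsemimod_closed (homog p).
Proof.
apply: GRing.submod_closed_semi; split.
  by apply/forallP => i; rewrite ffunE eqxx.
move=> k a b /forallP Ha /forallP Hb; apply/forallP => i; rewrite !ffunE.
apply/implyP; apply: contraR => npi.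
move: (Ha i) (Hb i); rewrite (negPf npi) !implybF !negbK => /eqP -> /eqP ->.
by rewrite scaler0 addr0.
Qed.

HB.instance Definition _ p :=
  GRing.isSubmodClosed.Build K model_space (homog p) (homog_submod p).

Lemma word_parityU S T : [disjoint S & T] ->
  word_parity (S :|: T) = word_parity S (+) word_parity T.
Proof.
move=> dST; rewrite /word_parity -oddD -bigU //; congr odd.
by apply: eq_bigl => s; rewrite !inE.
Qed.

Lemma word_parity_left i : word_parity (lword i) = index_parity i.
Proof. by case: i => [x|A] //=; rewrite /word_parity big_set1 oddb. Qed.

Lemma word_parity_right i : word_parity (rword i) = index_parity i.
Proof. by case: i => [x|A] //=; rewrite /word_parity big_set1 oddb. Qed.

Lemma homogP p a i : a \in homog p -> a i != 0 -> index_parity i = p.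
Proof. by move=> /forallP/(_ i)/implyP H /H/eqP. Qed.

Lemma homogE p a : a \in homog p ->
  a = \sum_(i | index_parity i == p) a i *: bvec i.
Proof.
move=> Ha; apply/ffunP => j.
rewrite sum_ffunE big_mkcond (bigD1 j) //= big1 ?addr0 => [|i nij].
  rewrite !ffunE eqxx; case: ifPn => [_|npj]; first by rewrite [_ *: _]mulr1.
  by apply: contraNeq npj => /(homogP Ha) ->.
by case: ifP => // _; rewrite !ffunE eq_sym (negPf nij) scaler0.
Qed.

Lemma homog_basis i : bvec i \in homog (index_parity i).
Proof.
apply/forallP => j; rewrite ffunE.
by case: (eqVneq j i) => [->|_]; rewrite ?eqxx ?implybT.
Qed.

Lemma homog_mul p q a b :
  a \in homog p -> b \in homog q -> model_mul a b \in homog (p (+) q).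
Proof.
move=> Ha Hb; apply: rpred_sum => i _; apply: rpred_sum => j _.
have [->|/(homogP Ha) <-] := eqVneq (a i) 0.
  by rewrite !mul0r scale0r rpred0.
have [->|/(homogP Hb) <-] := eqVneq (b j) 0.
  by rewrite mulr0 mul0r scale0r rpred0.
have [->|] := eqVneq (word_sgn (lword i) (rword j)) 0.
  by rewrite mulr0 scale0r rpred0.
rewrite word_sgn_neq0 => /word_parityU.
rewrite word_parity_left word_parity_right => <-.
exact/rpredZ/homog_basis.
Qed.

Lemma homog_span a : exists a0 a1,
  [/\ a0 \in homog false, a1 \in homog true & a = a0 + a1].
Proof.
exists [ffun i => if index_parity i then 0 else a i].
exists [ffun i => if index_parity i then a i else 0]; split.
- apply/forallP => i; rewrite ffunE.
  by case: (index_parity i); rewrite ?eqxx ?implybT.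
- apply/forallP => i; rewrite ffunE.
  by case: (index_parity i); rewrite ?eqxx ?implybT.
- apply/ffunP => i; rewrite !ffunE.
  by case: (index_parity i); rewrite ?add0r ?addr0.
Qed.

Lemma homog_direct a : a \in homog false -> a \in homog true -> a = 0.
Proof.
move=> H0 H1; apply/ffunP => i; rewrite [RHS]ffunE; apply/eqP.
by apply: contraT => ai; have := homogP H0 ai; rewrite (homogP H1 ai).
Qed.

Definition model : superalgebra K :=
  Superalgebra (smul := model_mul)
    (part := fun p => GRing.SubmodClosed.clone K model_space (homog p) _)
    homog_mul homog_span homog_direct.

Local Notation e i := (bvec i : model).

Lemma mul_basis i j :
  e i ** e j = word_sgn (lword i) (rword j) *: e (inr (lword i :|: rword j)).
Proof.
rewrite /= /model_mul (bigD1 i) //= (bigD1 j) //= !ffunE !eqxx !mul1r.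
rewrite big1 => [|k nk]; last by rewrite !ffunE (negPf nk) mulr0 mul0r scale0r.
rewrite addr0 big1 ?addr0 // => k nk; rewrite big1 // => l _.
by rewrite ffunE (negPf nk) !mul0r scale0r.
Qed.

(** Both sides are multiples of the same word; by the cocycle identity, they differ
by the sign of exchanging the left words of [i] and [j]. *)
Lemma mul_basis_left i j k :
  e i ** (e j ** e k) =
    (-1) ^+ (index_parity i && index_parity j) *: (e j ** (e i ** e k)).
Proof.
rewrite !mul_basis !smulZr !mul_basis !scalerA /= setUCA; congr (_ *: _).
rewrite mulrC -mulrA [word_sgn (lword i) (rword k) * _]mulrC.
rewrite -!word_sgn_cocycle (setUC (lword j)) mulrA; congr (_ * _).
by rewrite word_sgnC !word_parity_left.
Qed.

Lemma mul_basis_right i j k :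
  (e i ** e j) ** e k =
    (-1) ^+ (index_parity j && index_parity k) *: ((e i ** e k) ** e j).
Proof.
rewrite !mul_basis !smulZl !mul_basis !scalerA /= setUAC; congr (_ *: _).
rewrite -mulrA !word_sgn_cocycle (setUC (rword j)) mulrCA; congr (_ * _).
by rewrite word_sgnC !word_parity_right.
Qed.

Lemma model_bicommutative : bicommutative model.
Proof.
apply: (@bicommutative_basis K model _ bvec index_parity).
- by move=> p a /homogE ?; exists a.
- exact: mul_basis_left.
- exact: mul_basis_right.
Qed.

(** [label] names the infinitely many generators by the finitely many letters of
the model; it only has to be injective on the generators that matter. *)
Section ModelEval.
Variable label : generator -> G.
Hypothesis label_parity : forall x, parity (label x) = x.1.

Definition model_gen (x : generator) : model := bvec (inl (label x)).

Fixpoint mono_index (m : monomial) : model_index :=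
  match m with
  | Var x => inl (label x)
  | Prod m1 m2 => inr (lword (mono_index m1) :|: rword (mono_index m2))
  end.

Fixpoint mono_coef (m : monomial) : K :=
  match m with
  | Var x => 1
  | Prod m1 m2 => mono_coef m1 * mono_coef m2 *
      word_sgn (lword (mono_index m1)) (rword (mono_index m2))
  end.

Lemma model_gen_parity : parity_preserving model_gen.
Proof. by move=> x; rewrite -label_parity; apply: homog_basis. Qed.

Lemma eval_model m : eval model_gen m = mono_coef m *: e (mono_index m).
Proof.
elim: m => [x|m1 IH1 m2 IH2]; first by rewrite scale1r.
have -> :
    eval model_gen (Prod m1 m2) = eval model_gen m1 ** eval model_gen m2 by [].
by rewrite IH1 IH2 smulZl smulZr mul_basis !scalerA.
Qed.

Lemma index_support m s :
  s \in lword (mono_index m) :|: rword (mono_index m) ->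
  exists x, (0 < degree_in x m)%N /\ label x = s.2.
Proof.
elim: m => [x|m1 IH1 m2 IH2] /=.
  by rewrite !inE => /orP [] /eqP ->; exists x; rewrite /= eqxx.
rewrite setUid inE => /orP [] H; [case: IH1 | case: IH2].
- by rewrite inE H.
- by move=> x [Hx <-]; exists x; rewrite addn_gt0 Hx.
- by rewrite inE H orbT.
- by move=> x [Hx <-]; exists x; rewrite addn_gt0 Hx orbT.
Qed.

(** In a multilinear monomial no letter is met twice, so no sign is 0. *)
Lemma mono_coef_neq0 m :
  (forall x, degree_in x m <= 1)%N ->
  (forall x y, (0 < degree_in x m)%N -> (0 < degree_in y m)%N ->
     label x = label y -> x = y) ->
  mono_coef m != 0.
Proof.
elim: m => [x|m1 IH1 m2 IH2] /= d1 inj; first exact: oner_neq0.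
rewrite !mulf_neq0 ?IH1 ?IH2 //.
- by move=> x; apply: leq_trans (d1 x); apply: leq_addr.
- by move=> x y Hx Hy; apply: inj; rewrite addn_gt0 ?Hx ?Hy.
- by move=> x; apply: leq_trans (d1 x); apply: leq_addl.
- by move=> x y Hx Hy; apply: inj; rewrite addn_gt0 ?Hx ?Hy orbT.
rewrite word_sgn_neq0; apply/pred0P => s; apply/negP => /andP [/= s1 s2].
have [x [dx rx]] : exists x, (0 < degree_in x m1)%N /\ label x = s.2.
  by apply: index_support; rewrite inE s1.
have [y [dy ry]] : exists x, (0 < degree_in x m2)%N /\ label x = s.2.
  by apply: index_support; rewrite inE s2 orbT.
have exy : x = y by apply: inj; rewrite ?addn_gt0 ?dx ?dy ?orbT // rx ry.
by have := d1 x; rewrite leqNgt -addn1 leq_add // exy.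
Qed.

End ModelEval.
End Model.

(** * Normal form of a product up to sign *)

Section NormalForm.
Variables (K : fieldType) (A : superalgebra K) (g : generator -> A).
Hypotheses (bicA : bicommutative A) (parityg : parity_preserving g).

(** Replacing a vector by its opposite does not change spans, and forgetting signs
turns the defining identities into plain commutation rules. *)
Definition sign_eq (m m' : monomial) : Prop :=
  exists b : bool, eval g m = (-1) ^+ b *: eval g m'.
Local Notation "m ~~~ m'" := (sign_eq m m') (at level 70).

Lemma sign_eq_refl m : m ~~~ m.
Proof. by exists false; rewrite scale1r. Qed.

Lemma sign_eq_sym m m' : m ~~~ m' -> m' ~~~ m.
Proof. by case=> b e; exists b; rewrite e scalerA -expr2 sqrr_sign scale1r. Qed.

Lemma sign_eq_trans m1 m2 m3 : m1 ~~~ m2 -> m2 ~~~ m3 -> m1 ~~~ m3.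
Proof.
by case=> b e [c e']; exists (b (+) c); rewrite e e' scalerA -signr_addb.
Qed.

Lemma sign_eq_prod m1 m2 m1' m2' :
  m1 ~~~ m1' -> m2 ~~~ m2' -> Prod m1 m2 ~~~ Prod m1' m2'.
Proof.
case=> b e1 [c e2]; exists (b (+) c).
by rewrite /= e1 e2 linearZl_LR linearZr_LR scalerA signr_addb.
Qed.

Lemma sign_eq_prodl m1 m1' m2 : m1 ~~~ m1' -> Prod m1 m2 ~~~ Prod m1' m2.
Proof. by move=> H; apply: sign_eq_prod H (sign_eq_refl m2). Qed.

Lemma sign_eq_prodr m1 m2 m2' : m2 ~~~ m2' -> Prod m1 m2 ~~~ Prod m1 m2'.
Proof. exact: sign_eq_prod (sign_eq_refl m1). Qed.

Lemma eval_homogeneous m : exists p, eval g m \in part A p.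
Proof.
elim: m => [x|m1 [p1 H1] m2 [p2 H2]]; first by exists x.1; apply: parityg.
by exists (p1 (+) p2); apply: part_smul.
Qed.

Lemma sign_eq_left a b c : Prod a (Prod b c) ~~~ Prod b (Prod a c).
Proof.
have [p Ha] := eval_homogeneous a; have [q Hb] := eval_homogeneous b.
have [r Hc] := eval_homogeneous c.
by exists (p && q); have [] := bicA Ha Hb Hc.
Qed.

Lemma sign_eq_right a b c : Prod (Prod a b) c ~~~ Prod (Prod a c) b.
Proof.
have [p Ha] := eval_homogeneous a; have [q Hb] := eval_homogeneous b.
have [r Hc] := eval_homogeneous c.
by exists (q && r); have [] := bicA Ha Hb Hc.
Qed.

Definition is_prod m := if m is Prod _ _ then true else false.

(** Left and right multiplications commute on products.  With [m = x y], both
monomials can be rewritten to [(a y) (x c)]: from [a ((x y) c)], pass through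
[(x y) (a c)], [(x (a c)) y] and [(a (x c)) y]; from there go on through
[x ((a y) c)], [x ((a c) y)] and [(a c) (x y)] to [(a (x y)) c]. *)
Lemma sign_eq_leftright a m c : is_prod m ->
  Prod a (Prod m c) ~~~ Prod (Prod a m) c.
Proof.
case: m => // x y _.
apply: sign_eq_trans (sign_eq_left _ _ _) _.
apply: sign_eq_trans (sign_eq_right _ _ _) _.
apply: sign_eq_trans (sign_eq_prodl _ (sign_eq_left _ _ _)) _.
apply: sign_eq_trans (sign_eq_right _ _ _) _.
apply: sign_eq_trans (sign_eq_left _ _ _) _.
apply: sign_eq_trans (sign_eq_prodr _ (sign_eq_right _ _ _)) _.
apply: sign_eq_trans (sign_eq_left _ _ _) _.
exact: sign_eq_right.
Qed.

Definition lmuls (s : seq generator) m := foldr (fun x => Prod (Var x)) m s.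
Definition rmuls m (t : seq generator) :=
  foldl (fun m' y => Prod m' (Var y)) m t.

Lemma rmuls_rcons m t y : rmuls m (rcons t y) = Prod (rmuls m t) (Var y).
Proof. exact: foldl_rcons. Qed.

Lemma sign_eq_lmuls s m m' : m ~~~ m' -> lmuls s m ~~~ lmuls s m'.
Proof. by move=> H; elim: s => //= x s; apply: sign_eq_prodr. Qed.

Lemma sign_eq_rmuls t m m' : m ~~~ m' -> rmuls m t ~~~ rmuls m' t.
Proof. by elim: t m m' => //= x t IH m m' H; apply/IH/sign_eq_prodl. Qed.

Lemma is_prod_rmuls m t : is_prod m -> is_prod (rmuls m t).
Proof. by elim: t m => //= x t IH m _; apply: IH. Qed.

Lemma is_prod_lmuls s m : s != [::] -> is_prod (lmuls s m).
Proof. by case: s. Qed.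

Lemma perm_lmuls s s' m : perm_eq s s' -> lmuls s m ~~~ lmuls s' m.
Proof.
elim: s s' => [|x s IH] s'.
  by move/perm_size; case: s' => // _; apply: sign_eq_refl.
move=> pss'; have xs' : x \in s' by rewrite -(perm_mem pss') mem_head.
case/splitPr: s' / xs' pss' => s1 s2 pss'.
have {}pss' : perm_eq s (s1 ++ s2).
  rewrite -(perm_cons x); apply: perm_trans pss' _.
  by rewrite -cat1s perm_catCA.
apply: sign_eq_trans (sign_eq_prodr _ (IH _ pss')) _.
elim: s1 {IH s pss'} => [|y s1 IH] /=; first exact: sign_eq_refl.
by apply: sign_eq_trans (sign_eq_left _ _ _) _; apply: sign_eq_prodr.
Qed.

Lemma perm_rmuls t t' m : perm_eq t t' -> rmuls m t ~~~ rmuls m t'.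
Proof.
elim: t t' m => [|x t IH] t' m.
  by move/perm_size; case: t' => // _; apply: sign_eq_refl.
move=> ptt'; have xt' : x \in t' by rewrite -(perm_mem ptt') mem_head.
case/splitPr: t' / xt' ptt' => t1 t2 ptt'.
have {}ptt' : perm_eq t (t1 ++ t2).
  rewrite -(perm_cons x); apply: perm_trans ptt' _.
  by rewrite -cat1s perm_catCA.
apply: sign_eq_trans (IH _ _ ptt') _.
elim: t1 m {IH t ptt'} => [|y t1 IH] m /=; first exact: sign_eq_refl.
by apply: sign_eq_trans _ (IH _); apply: sign_eq_rmuls; apply: sign_eq_right.
Qed.

Lemma sign_eq_mul_rmuls a m t : is_prod m ->
  Prod a (rmuls m t) ~~~ rmuls (Prod a m) t.
Proof.
move=> pm; elim/last_ind: t => [|t y IH]; first exact: sign_eq_refl.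
rewrite !rmuls_rcons.
apply: sign_eq_trans (sign_eq_leftright _ _ (is_prod_rmuls _ pm)) _.
exact: sign_eq_prodl.
Qed.

Lemma sign_eq_mul_lmuls a s m : Prod a (lmuls s m) ~~~ lmuls s (Prod a m).
Proof.
elim: s => [|x s IH] /=; first exact: sign_eq_refl.
by apply: sign_eq_trans (sign_eq_left _ _ _) _; apply: sign_eq_prodr.
Qed.

Lemma sign_eq_lmuls_rmuls s m t : is_prod m ->
  lmuls s (rmuls m t) ~~~ rmuls (lmuls s m) t.
Proof.
move=> pm; elim: s => [|x s IH] /=; first exact: sign_eq_refl.
apply: sign_eq_trans (sign_eq_prodr _ IH) _; apply: sign_eq_mul_rmuls.
by case: s {IH}.
Qed.

(** The innermost right letter [j] of a normal monomial is on the same footing as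
the outer ones: [k] travels inwards through the left letters down to [i j],
where right commutativity exchanges the two. *)
Lemma swap_last_right s j k : s != [::] ->
  Prod (lmuls s (Var j)) (Var k) ~~~ Prod (lmuls s (Var k)) (Var j).
Proof.
elim: s => // i [|i' s] IH _; first exact: sign_eq_right.
apply: sign_eq_trans (sign_eq_sym (sign_eq_leftright _ _ _)) _ => //.
apply: sign_eq_trans (sign_eq_prodr _ (IH _)) _ => //.
exact: sign_eq_leftright.
Qed.

(** The right part is [j :: t], with its first letter [j] placed innermost. *)
Definition normal_monomial s j t := rmuls (lmuls s (Var j)) t.

Lemma perm_normal_monomial s j t s' j' t' : s != [::] ->
  perm_eq s s' -> perm_eq (j :: t) (j' :: t') ->
  normal_monomial s j t ~~~ normal_monomial s' j' t'.
Proof.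
move=> s0 pss' ptt'.
apply: sign_eq_trans (sign_eq_rmuls _ (perm_lmuls _ pss')) _.
have {}s0 : s' != [::] by rewrite -size_eq0 -(perm_size pss') size_eq0.
have [ejj'|njj'] := eqVneq j j'.
  by rewrite ejj' perm_cons in ptt' *; apply: perm_rmuls.
have : j' \in t.
  by move: (mem_head j' t'); rewrite -(perm_mem ptt') inE eq_sym (negPf njj').
move=> /perm_to_rem pt; set t0 := rem j' t in pt.
apply: sign_eq_trans (perm_rmuls _ pt) _ => /=.
apply: sign_eq_trans (sign_eq_rmuls _ (swap_last_right _ _ s0)) _.
apply: (perm_rmuls (t := j :: t0)); rewrite -(perm_cons j').
apply: perm_trans ptt'.
have swap : perm_eq (j' :: j :: t0) (j :: j' :: t0).
  exact/permPl/(perm_catCA [:: j'] [:: j]).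
by apply: perm_trans swap _; rewrite perm_cons perm_sym.
Qed.

Definition has_degrees m (s : seq generator) :=
  forall x, degree_in x m = count_mem x s.

Lemma degree_lmuls s m x :
  degree_in x (lmuls s m) = (count_mem x s + degree_in x m)%N.
Proof. by elim: s => //= y s ->; rewrite addnA. Qed.

Lemma degree_rmuls t m x :
  degree_in x (rmuls m t) = (degree_in x m + count_mem x t)%N.
Proof. by elim: t m => [|y t IH] m /=; rewrite ?addn0 // IH /= addnA. Qed.

Lemma degree_normal_monomial s j t :
  has_degrees (normal_monomial s j t) (s ++ j :: t).
Proof. by move=> x; rewrite degree_rmuls degree_lmuls count_cat /= addnA. Qed.

(** In a product of two normal monomials [m1 m2], the right letters of [m2] other
than its innermost one come out to the right and its left letters come out to
the left; what is left of [m2] is a single letter, which multiplies [m1] from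
the right. *)
Lemma normal_form m : is_prod m ->
  exists s j t, [/\ s != [::], m ~~~ normal_monomial s j t
    & has_degrees m (s ++ j :: t)].
Proof.
elim: m => // m1 IH1 m2 IH2 _.
case: m1 IH1 => [x _|a1 b1 [//|s1 [j1 [t1 [s10 e1 d1]]]]].
  case: m2 IH2 => [y _|a2 b2 [//|s2 [j2 [t2 [s20 e2 d2]]]]].
    exists [:: x], y, [::]; split=> //; first exact: sign_eq_refl.
    by move=> z /=; rewrite addn0.
  exists (x :: s2), j2, t2; split=> //; last by move=> z /=; have /= -> := d2 z.
  apply: sign_eq_trans (sign_eq_prodr _ e2) _.
  exact/sign_eq_mul_rmuls/is_prod_lmuls.
case: m2 IH2 => [y _|a2 b2 [//|s2 [j2 [t2 [s20 e2 d2]]]]].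
  exists s1, j1, (rcons t1 y); split=> //.
    by rewrite /normal_monomial rmuls_rcons; apply: sign_eq_prodl.
  move=> z; rewrite -cats1 -cat_cons catA count_cat -d1 /=.
  by rewrite addn0.
exists (s2 ++ s1), j1, (rcons t1 j2 ++ t2); split.
- by case: s2 s20 {e2 d2}.
- apply: sign_eq_trans (sign_eq_prod e1 e2) _.
  apply: sign_eq_trans (sign_eq_mul_rmuls _ _ (is_prod_lmuls _ s20)) _.
  rewrite /normal_monomial /rmuls foldl_cat -/(rmuls _ _) -/(rmuls _ _).
  apply: sign_eq_rmuls.
  apply: sign_eq_trans (sign_eq_mul_lmuls _ _ _) _.
  rewrite /lmuls foldr_cat -/(lmuls _ _) -/(lmuls _ _) -rmuls_rcons.
  exact/sign_eq_lmuls_rmuls/is_prod_lmuls.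
move=> z; rewrite /= -/(degree_in z (Prod a1 b1)) -/(degree_in z (Prod a2 b2)).
rewrite d1 d2 -cats1 !count_cat /= !count_cat /=.
ring.
Qed.

End NormalForm.

(** * Words of normal monomials in the model *)

Section NfIndex.
Variables (G : finType) (label : generator -> G).

Definition letters (s t : seq generator) : {set letter G} :=
  [set y in [seq (false, label x) | x <- s] ++ [seq (true, label x) | x <- t]].

Lemma index_prod m : is_prod m ->
  mono_index label m = inr (lword (mono_index label m)).
Proof. by case: m. Qed.

Lemma rword_lmuls s j :
  rword (mono_index label (lmuls s (Var j))) = letters s [:: j].
Proof.
elim: s => [|x s IH] /=; first by apply/setP => y; rewrite !inE.
by rewrite IH; apply/setP => y; rewrite !inE.
Qed.

Lemma lword_rmuls m t : is_prod m ->
  lword (mono_index label (rmuls m t)) =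
    lword (mono_index label m) :|: letters [::] t.
Proof.
move=> pm; elim/last_ind: t => [|t x IH].
  by apply/setP => y; rewrite !inE orbF.
rewrite rmuls_rcons /= IH; apply/setP => y.
by rewrite !inE /= map_rcons mem_rcons inE -orbA; congr orb; rewrite orbC.
Qed.

Lemma index_normal_monomial s j t : s != [::] ->
  mono_index label (normal_monomial s j t) = inr (letters s (j :: t)).
Proof.
move=> s0; have pL := is_prod_lmuls (Var j) s0.
rewrite index_prod ?is_prod_rmuls // lword_rmuls //; congr inr.
have -> : lword (mono_index label (lmuls s (Var j))) = letters s [:: j].
  by rewrite -rword_lmuls; case: s s0 {pL}.
by apply/setP => y; rewrite !inE !mem_cat !inE -orbA.
Qed.

Lemma mem_letters_left s t x :
  ((false, label x) \in letters s t) = (label x \in map label s).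
Proof.
rewrite inE mem_cat orbC; case: mapP => [[y _ []]//|_ /=].
by apply/mapP/mapP => [[y ys [->]]|[y ys ->]]; exists y.
Qed.

Lemma mem_letters_right s t x :
  ((true, label x) \in letters s t) = (label x \in map label t).
Proof.
rewrite inE mem_cat; case: mapP => [[y _ []]//|_ /=].
by apply/mapP/mapP => [[y ys [->]]|[y ys ->]]; exists y.
Qed.

End NfIndex.

(** * Dimension of a sum of multilinear components *)

Section Family.
Variables (K : fieldType) (F : superalgebra K) (g : generator -> F).
Hypothesis freeF : free_bicommutative g.

Lemma hom_eval (A : superalgebra K) (h : generator -> A) (f : {linear F -> A}) :
  superalgebra_hom f -> (forall x, f (g x) = h x) ->
  forall m, f (eval g m) = eval h m.
Proof.
by move=> [fM _] fg; elim=> //= m1 IH1 m2 IH2; rewrite fM IH1 IH2.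
Qed.

(** The map to the model given by the universal property sends the monomials to
nonzero multiples of distinct basis vectors. *)
Lemma monomials_free (d : nat) (m : 'I_d -> monomial) (G : finType)
    (label : generator -> G) (parity : G -> bool) :
  (forall x, parity (label x) = x.1) ->
  injective (mono_index label \o m) ->
  (forall i x, degree_in x (m i) <= 1)%N ->
  (forall i x y, (0 < degree_in x (m i))%N -> (0 < degree_in y (m i))%N ->
     label x = label y -> x = y) ->
  forall c : 'I_d -> K, \sum_i c i *: eval g (m i) = 0 -> forall i, c i = 0.
Proof.
move=> label_parity inj d1 label_inj c c0 k.
have [_ _ /(_ (model K parity) (model_gen K parity label))] := freeF.
case; [exact: model_bicommutative | exact: model_gen_parity |].
move=> f [fhom fg _].
have := congr1 f c0; rewrite linear0 linear_sum.
under eq_bigr do rewrite linearZ_LR (hom_eval fhom fg) eval_model scalerA.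
move/(congr1 (fun a : {ffun model_index G -> K^o} =>
  a (mono_index label (m k)))).
rewrite sum_ffunE (bigD1 k) //= !ffunE eqxx big1 => [|i nik]; last first.
  by rewrite !ffunE (inj_eq inj) eq_sym (negPf nik) scaler0.
rewrite addr0 => /eqP; rewrite [_ *: _]mulr1 mulf_eq0 => /orP [/eqP //|m0].
by have := @mono_coef_neq0 K G parity label _ (d1 k) (label_inj k); rewrite m0.
Qed.

Lemma multilinear_ext (V V' : pred generator) v :
  V =1 V' -> multilinear g V v -> multilinear g V' v.
Proof.
by move=> e [n [c [m [dm ->]]]]; exists n, c, m; split=> // i x; rewrite dm e.
Qed.

Definition family_space (E : finType) (V : E -> pred generator) (v : F) :
    Prop :=
  exists w : E -> F, (forall e, multilinear g (V e) (w e)) /\ v = \sum_e w e.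

Lemma has_dim_monomials (E : finType) (V : E -> pred generator) (d : nat)
    (m : 'I_d -> monomial) (cls : 'I_d -> E) :
  (forall i x, degree_in x (m i) = V (cls i) x) ->
  (forall e m', (forall x, degree_in x m' = V e x) ->
     exists i, sign_eq g m' (m i)) ->
  (forall c : 'I_d -> K, \sum_i c i *: eval g (m i) = 0 -> forall i, c i = 0) ->
  has_dim (family_space V) d.
Proof.
move=> dm norm indep.
exists (fun i => eval g (m i)); split=> // [i|v [w [Vw ->]]].
  exists (fun e => if e == cls i then eval g (m i) else 0); split=> [e|].
    case: eqP => [->|_].
      exists 1%N, (fun=> 1), (fun=> m i); split=> [_ x|]; first exact: dm.
      by rewrite big_ord1 scale1r.
    exists 0%N, (fun=> 0), (fun=> m i); split=> [[]//|].
    by rewrite big_ord0.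
  by rewrite -big_mkcond big_pred1_eq.
pose span v := exists c : 'I_d -> K, v = \sum_i c i *: eval g (m i).
have span0 : span 0.
  by exists (fun=> 0); rewrite big1 // => i _; rewrite scale0r.
have spanD a b : span a -> span b -> span (a + b).
  move=> [c ->] [c' ->]; exists (fun i => c i + c' i).
  by rewrite -big_split; apply: eq_bigr => i _; rewrite scalerDl.
have spanZ k a : span a -> span (k *: a).
  move=> [c ->]; exists (fun i => k * c i).
  by rewrite scaler_sumr; apply: eq_bigr => i _; rewrite scalerA.
apply: (big_ind span) => // e _; have [n [c [m' [dm' ->]]]] := Vw e.
apply: (big_ind span) => // j _; apply: (spanZ (c j)).
have [i [b ->]] := norm e (m' j) (dm' j); apply: spanZ.
exists (fun k => (k == i)%:R).
rewrite (bigD1 i) //= eqxx scale1r big1 ?addr0 //.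
by move=> k /negPf ->; rewrite scale0r.
Qed.

Let bicF : bicommutative F. Proof. by case: freeF. Qed.
Let parityg : parity_preserving g. Proof. by case: freeF. Qed.

(** In the rest of the section, [f e] lists without repetition the [n] generators
of the set indexed by [e], and distinct indices give distinct sets. *)
Section Codomains.
Variables (E : finType) (n : nat) (f : E -> 'I_n -> generator).
Hypotheses (f_inj : forall e, injective (f e)).
Hypotheses (f_sep : forall e e', (codom (f e)) =i (codom (f e')) -> e = e').

(* The bound [N] on the positions of the generators involved makes [label]
   injective on them. *)
Let N := \max_e \max_i (f e i).2.
Let G : Type := (bool * 'I_N.+1)%type.
Let label (x : generator) : G := (x.1, inord x.2).

Let label_inj e e' i i' : label (f e i) = label (f e' i') -> f e i = f e' i'.
Proof.
have bound d j : ((f d j).2 < N.+1)%N.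
  by rewrite ltnS; apply: leq_trans (leq_bigmax d); apply: (leq_bigmax j).
move: (bound e i) (bound e' i'); rewrite /label.
case: (f e i) (f e' i') => [p a] [q b] /= Ha Hb [-> /(congr1 val)].
by rewrite /= !inordK // => ->.
Qed.

Definition vars e : pred generator := [pred x | x \in codom (f e)].

Let uniq_codom e : uniq (codom (f e)).
Proof. by rewrite map_inj_uniq ?enum_uniq. Qed.

Lemma degrees_perm e m s :
  has_degrees m s -> (forall x, degree_in x m = vars e x) ->
  perm_eq s (codom (f e)).
Proof.
move=> ds dm; apply/allP => x _ /=.
by rewrite -ds dm count_uniq_mem.
Qed.

Lemma has_dim_one : n = 1%N ->
  has_dim (family_space vars) #|E|.
Proof.
move=> n1; have i0 : 'I_n by rewrite n1; exact: ord0.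
have all0 (i : 'I_n) : i = i0.
  apply: val_inj => /=; move: (ltn_ord i) (ltn_ord i0).
  rewrite [X in (_ < X)%N -> _]n1 [X in _ -> (_ < X)%N -> _]n1.
  by rewrite !ltnS !leqn0 => /eqP-> /eqP->.
have codom1 e x : (x \in codom (f e)) = (f e i0 == x).
  by apply/codomP/eqP => [[i ->]|<-]; [rewrite (all0 i) | exists i0].
apply: (has_dim_monomials (m := fun i => Var (f (enum_val i) i0))
  (cls := fun i => enum_val i)).
- by move=> i x; rewrite /vars /= codom1.
- move=> e [x|m1 m2] dm.
    exists (enum_rank e); rewrite enum_rankK; move: (dm x).
    by rewrite /vars /= eqxx codom1; case: eqP => // -> _; apply: sign_eq_refl.
  have [|s [j [t [s0 _ ds]]]] :=
    @normal_form _ _ _ bicF parityg (Prod m1 m2) => //.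
  have /perm_size := degrees_perm ds dm.
  case: s s0 {ds} => // x s _.
  by rewrite size_codom card_ord n1 /= size_cat addnS.
- apply: (@monomials_free _ _ G label (fun x => x.1)) => //.
  + move=> i i' ri; have e := label_inj (inl_inj ri).
    by apply/enum_val_inj/f_sep => x; rewrite !codom1 e.
  + by move=> i x /=; case: eqP.
  + by move=> i x y /=; case: eqP => // <- _; case: eqP => // <-.
Qed.

(** An index [e] with a splitting of the positions of its generators into a left
part and its complement, both nonempty. *)
Definition proper_part : Type :=
  {u : E * {set 'I_n} | (u.2 != set0) && (u.2 != setT)}.

Lemma card_proper_part : (0 < n)%N ->
  #|{: proper_part}| = (#|E| * (2 ^ n - 2))%N.
Proof.
move=> n0; rewrite card_sig.
transitivity #|setX [set: E] ([set: {set 'I_n}] :\ set0 :\ setT)|.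
  by apply: eq_card => u; rewrite !inE andbT andbC.
rewrite cardsX cardsT; congr muln.
have T0 : [set: 'I_n] != set0 by rewrite -card_gt0 cardsT card_ord.
have cT : #|[set: {set 'I_n}]| = (2 ^ n)%N.
  by rewrite -powersetT card_powerset cardsT card_ord.
rewrite -cT [in RHS](cardsD1 set0) [in RHS](cardsD1 setT (_ :\ _)) !inE T0.
by rewrite !add1n subn2.
Qed.

Let lpart (u : proper_part) := map (f (val u).1) (enum (val u).2).
Let rpart (u : proper_part) := map (f (val u).1) (enum (~: (val u).2)).
(* The right part is nonempty, so the default value of [head] is never reached. *)
Let mono u :=
  normal_monomial (lpart u) (head (false, 0%N) (rpart u)) (behead (rpart u)).

Let lpart_neq0 u : lpart u != [::].
Proof.
have /andP [I0 _] := valP u.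
by rewrite -size_eq0 size_map -cardE cards_eq0.
Qed.

Let rpartE u : head (false, 0%N) (rpart u) :: behead (rpart u) = rpart u.
Proof.
have: rpart u != [::].
  have /andP [_ IT] := valP u.
  rewrite -size_eq0 size_map -cardE cards_eq0; apply/eqP => C0.
  by move: IT; rewrite -[(val u).2]setCK C0 setC0 eqxx.
by case: rpart.
Qed.

Let perm_parts u : perm_eq (lpart u ++ rpart u) (codom (f (val u).1)).
Proof.
rewrite -map_cat; apply/perm_map/uniq_perm; rewrite ?enum_uniq //.
  rewrite cat_uniq !enum_uniq andbT /=; apply/hasPn => i.
  by rewrite !mem_enum inE.
by move=> i; rewrite mem_cat !mem_enum !inE orbN.
Qed.

Let degree_mono u x : degree_in x (mono u) = vars (val u).1 x.
Proof.
by rewrite degree_normal_monomial rpartE (permP (perm_parts u)) count_uniq_mem.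
Qed.

Let normalize e m : (1 < n)%N -> (forall x, degree_in x m = vars e x) ->
  exists u, sign_eq g m (mono u).
Proof.
move=> n1 dm; case: m dm => [x dm|m1 m2 dm].
  have dx : has_degrees (Var x) [:: x] by move=> y; rewrite /= addn0.
  have := perm_size (degrees_perm dx dm).
  by rewrite size_codom card_ord /= => n1'; rewrite -n1' in n1.
have [|s [j [t [s0 em ds]]]] :=
  @normal_form _ _ _ bicF parityg (Prod m1 m2) => //.
have p := degrees_perm ds dm.
have : uniq (s ++ j :: t) by rewrite (perm_uniq p).
rewrite cat_uniq => /and3P [us /hasPn dis ut].
pose I := [set i | f e i \in s].
have I0 : I != set0.
  case: s s0 @I p {em ds us dis} => // x s _ I p.
  have /codomP [i xi] : x \in codom (f e) by rewrite -(perm_mem p) mem_head.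
  by apply/set0Pn; exists i; rewrite inE -xi mem_head.
have IT : I != setT.
  have /codomP [i ji] : j \in codom (f e).
    by rewrite -(perm_mem p) mem_cat mem_head orbT.
  apply/eqP => /setP /(_ i); rewrite !inE -ji.
  by apply/negP; exact: dis (mem_head _ _).
have IP : (I != set0) && (I != setT) by rewrite I0.
exists (exist _ (e, I) IP); apply: sign_eq_trans em _.
apply: perm_normal_monomial => //.
  apply: uniq_perm; rewrite ?map_inj_uniq ?enum_uniq // => x.
  apply/idP/mapP => [xs|[i]]; last by rewrite mem_enum inE => ? ->.
  have /codomP [i xi] : x \in codom (f e) by rewrite -(perm_mem p) mem_cat xs.
  by exists i; rewrite ?mem_enum ?inE -?xi.
rewrite rpartE; apply: uniq_perm; rewrite ?map_inj_uniq ?enum_uniq // => x.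
apply/idP/mapP => [xt|[i]].
  have /codomP [i xi] : x \in codom (f e).
    by rewrite -(perm_mem p) mem_cat xt orbT.
  by exists i; rewrite ?mem_enum ?inE -?xi //; apply: dis.
rewrite mem_enum !inE => ni ->.
by have := codom_f (f e) i; rewrite -(perm_mem p) mem_cat (negPf ni).
Qed.

Let mem_map_label e (s : seq 'I_n) d k :
  (label (f d k) \in map label (map (f e) s)) = (f d k \in map (f e) s).
Proof.
apply/mapP/idP => [[_ /mapP [i si ->] /label_inj ->]|]; first exact: map_f.
by move=> H; exists (f d k).
Qed.

Let mem_parts u x :
  (x \in codom (f (val u).1)) = (x \in lpart u) || (x \in rpart u).
Proof.
by rewrite -(perm_mem (perm_parts u)) mem_cat.
Qed.

(* The word of a normal monomial contains [u_x] for [x] in the left part and [v_x]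
   for [x] in the right part; the two parts together determine the index [e]. *)
Let mono_inj : injective (mono_index label \o mono).
Proof.
move=> u u'; rewrite /= !index_normal_monomial // !rpartE => -[eqL].
have eql d k : (f d k \in lpart u) = (f d k \in lpart u').
  rewrite -[LHS]mem_map_label -[RHS]mem_map_label.
  by rewrite -(mem_letters_left label _ (rpart u)) eqL mem_letters_left.
have eqr d k : (f d k \in rpart u) = (f d k \in rpart u').
  rewrite -[LHS]mem_map_label -[RHS]mem_map_label.
  by rewrite -(mem_letters_right label (lpart u)) eqL mem_letters_right.
have e1 : (val u).1 = (val u').1.
  apply: f_sep => x; apply/idP/idP => /[dup] /codomP [i ->].
    by rewrite !mem_parts eql eqr.
  by rewrite !mem_parts eql eqr.
have e2 : (val u).2 = (val u').2.
  apply/setP => k; have := eql (val u).1 k; rewrite /lpart -e1.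
  by rewrite !mem_map // !mem_enum.
by apply: val_inj; case: (val u) (val u') e1 e2 => [e I] [e' I'] /= -> ->.
Qed.

Lemma has_dim_many : (1 < n)%N ->
  has_dim (family_space vars) (#|E| * (2 ^ n - 2))%N.
Proof.
move=> n1; rewrite -card_proper_part ?(ltnW n1) //.
apply: (has_dim_monomials (m := fun i => mono (enum_val i))
  (cls := fun i => (val (enum_val i)).1)).
- by move=> i x; apply: degree_mono.
- move=> e m /(normalize n1) [u mu].
  by exists (enum_rank u); rewrite enum_rankK.
apply: (@monomials_free _ _ G label (fun x => x.1)) => //.
- by move=> i i' /mono_inj /enum_val_inj.
- by move=> i x; rewrite degree_mono leq_b1.
- move=> i x y; rewrite !degree_mono !lt0b => /codomP [k ->] /codomP [k' ->].
  exact: label_inj.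
Qed.

Lemma has_dim_family : (0 < n)%N ->
  has_dim (family_space vars)
    (if (1 < n)%N then #|E| * (2 ^ n - 2) else #|E|)%N.
Proof.
move=> n0; case: ltnP => [|n_le1]; first exact: has_dim_many.
by apply: has_dim_one; apply/eqP; rewrite eqn_leq n_le1.
Qed.

End Codomains.

End Family.

Lemma has_dim_ext (K : fieldType) (V : lmodType K) (S S' : V -> Prop) d :
  (forall v, S v <-> S' v) -> has_dim S d -> has_dim S' d.
Proof.
move=> SS' [b [bS b_free b_span]]; exists b; split=> // [i|v /SS'].
  by apply/SS'.
exact: b_span.
Qed.

(** The variables [y_1, ..., y_p, z_1, ..., z_q] in this order. *)
Definition split_var (p q : nat) (i : 'I_(p + q)) : generator :=
  match split i with
  | inl j => (false, val j)
  | inr j => (true, val j)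
  end.

Lemma split_var_inj p q : injective (@split_var p q).
Proof.
move=> i j; rewrite /split_var -{2}(splitK i) -{2}(splitK j).
by case: (split i) (split j) => [a|a] [b|b] [] // /val_inj ->.
Qed.

Lemma codom_split_var p q x :
  (x \in codom (@split_var p q)) = (if x.1 then x.2 < q else x.2 < p)%N.
Proof.
apply/codomP/idP => [[i ->]|]; first by rewrite /split_var; case: split => j /=.
case: x => [[] k] /= kb.
  exists (rshift p (Ordinal kb)).
  by rewrite /split_var -/(unsplit (inr _)) unsplitK.
exists (lshift q (Ordinal kb)).
by rewrite /split_var -/(unsplit (inl _)) unsplitK.
Qed.

Lemma codom_chosen n (e : {ffun 'I_n -> bool}) x :
  (x \in codom (fun i => (e i, val i))) = chosen e x.
Proof. by apply/codomP/existsP => [[i ->]|[i /eqP ->]]; exists i. Qed.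

(** * The codimensions *)

Theorem corollary3p4 (K : fieldType) (charK : 2%N \notin [pchar K]%R)
    (F : superalgebra K) (g : generator -> F) (freeF : free_bicommutative g) :
  (forall p q : nat, (0 < p + q)%N ->
     has_dim (P_pq g p q)
       (if (1 < p + q)%N then 2 ^ (p + q) - 2 else 1)%N) /\
  (forall n : nat, (1 <= n)%N ->
     has_dim (P_n g n)
       (if (1 < n)%N then 2 ^ (2 * n) - 2 ^ (n + 1) else 2)%N).
Proof.
split=> [p q pq_gt0|n n_gt0].
  have sep (e e' : unit) :
      codom (@split_var p q) =i codom (@split_var p q) -> e = e'.
    by case: e e' => [] [].
  have := has_dim_family freeF (fun=> @split_var_inj p q) sep pq_gt0.
  rewrite card_unit mul1n; apply: has_dim_ext => v.
  split=> [[w [Vw ->]]|Pv].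
    rewrite (big_pred1 tt) => [|[]//].
    by apply: multilinear_ext (Vw tt) => x; apply: codom_split_var.
  exists (fun=> v); split; last by rewrite (big_pred1 tt) => [|[]].
  by move=> e; apply: multilinear_ext Pv => x; rewrite -codom_split_var.
pose f (e : {ffun 'I_n -> bool}) i : generator := (e i, val i).
have f_inj e : injective (f e) by move=> i j /(congr1 snd)/val_inj.
have sep e e' : codom (f e) =i codom (f e') -> e = e'.
  move=> eq_c; apply/ffunP => i; have := codom_f (f e) i.
  rewrite eq_c => /codomP [j fij].
  have ij : i = j := val_inj (congr1 snd fij).
  by have := congr1 fst fij; rewrite ij.
have := has_dim_family freeF f_inj sep n_gt0.
have -> : (if 1 < n then #|{ffun 'I_n -> bool}| * (2 ^ n - 2)
           else #|{ffun 'I_n -> bool}|)%N =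
          (if 1 < n then 2 ^ (2 * n) - 2 ^ (n + 1) else 2)%N.
  rewrite card_ffun card_bool card_ord.
  rewrite mulnBr -expnD addnn mul2n addn1 expnSr.
  case: ltnP => // n_le1; rewrite (_ : n = 1)%N //.
  by apply/eqP; rewrite eqn_leq n_le1.
apply: has_dim_ext => v.
split=> [] [w [Vw ->]]; exists w; split=> // e.
  by apply: multilinear_ext (Vw e) => x; apply: codom_chosen.
by apply: multilinear_ext (Vw e) => x; rewrite -codom_chosen.
Qed.
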